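(* Let $L$ be a completely distributive lattice, $G$ a group and $\mu\in L(G)$. Then $\mu$ satisfies the maximal condition if and only if each proper ascending chain $\eta_1\subsetneq\eta_2\subsetneq\cdots$ of $L$-subgroups of $\mu$ is finite.
   Context: $L$ is a completely distributive lattice and $G$ is a group. An $L$-subset of $G$ is a function $G\to L$; $\eta\subseteq\mu$ means $\eta(x)\le\mu(x)$ for all $x\in G$, and $\eta\subsetneq\mu$ means $\eta\subseteq\mu$ and $\eta\neq\mu$. An $L$-subgroup of $G$ is an $L$-subset $\mu$ with $\mu(xy)\ge\mu(x)\wedge\mu(y)$ and $\mu(x^{-1})=\mu(x)$ for all $x,y\in G$; $L(G)$ is the set of these. For $\mu\in L(G)$, the $L$-subgroups of $\mu$ are the $\eta\in L(G)$ with $\eta\subseteq\mu$. $\mu$ satisfies the maximal condition if every non-empty set $S$ of $L$-subgroups of $\mu$ contains a maximal element, i.e. an element of $S$ not properly contained in any other element of $S$. *)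

(* Defs.v *)
From mathcomp Require Import all_boot all_order.
From mathcomp Require Import boolp classical_sets cardinality.

Set Implicit Arguments.
Unset Strict Implicit.
Unset Printing Implicit Defensive.

Local Open Scope classical_set_scope.

Definition complete_lattice (d : Order.disp_t) (L : latticeType d) : Prop :=
  forall A : set L, supremums A !=set0 /\ infimums A !=set0.

(* [supremums A x] says that x is the least upper bound of A.  The second     *)
(* conjunct is inf_i (sup (J i)) = sup_f (inf_i (f i)), where f ranges over   *)
(* the choice functions of the family J; here s i = sup (J i) and x is the    *)
(* left-hand side.                                                            *)
Definition completely_distributive (d : Order.disp_t) (L : latticeType d) :
    Prop :=
  complete_lattice L /\
  forall (I : Type) (J : I -> set L) (s : I -> L) (x : L),
    (forall i, supremums (J i) (s i)) ->
    infimums (range s) x ->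
    supremums [set y | exists2 f : I -> L,
                 forall i, J i (f i) & infimums (range f) y] x.

Section LSubsets.
Context (d : Order.disp_t) (L : latticeType d) (G : groupType).
Implicit Types eta mu : G -> L.

Definition Lsubset eta mu : Prop := forall x, (eta x <= mu x)%O.

Definition Lproper eta mu : Prop := Lsubset eta mu /\ eta <> mu.

Definition Lsubgroup mu : Prop :=
  (forall x y, (Order.meet (mu x) (mu y) <= mu (x * y)%g)%O) /\
  (forall x, mu (x^-1)%g = mu x).

Definition Lsubgroup_of mu eta : Prop := Lsubgroup eta /\ Lsubset eta mu.

Definition maximal_condition mu : Prop :=
  forall S : set (G -> L), S !=set0 -> S `<=` Lsubgroup_of mu ->
    exists2 eta, S eta & forall nu, S nu -> ~ Lproper eta nu.

(* The index set D is an initial segment of nat: either all of nat (infinite  *)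
(* chain) or {0, ..., n - 1} (chain with n terms); values of eta outside D    *)
(* are irrelevant.                                                            *)
Definition proper_ascending_chain mu (D : set nat) (eta : nat -> G -> L) :
    Prop :=
  [/\ forall m n, m <= n -> D n -> D m,
      forall n, D n -> Lsubgroup_of mu (eta n)
    & forall n, D n.+1 -> Lproper (eta n) (eta n.+1)].

End LSubsets.

(* Main.v *)
Require Import Defs.
From mathcomp Require Import all_boot all_order.
From mathcomp Require Import boolp classical_sets cardinality.

(** The equivalence is the usual one between the maximal condition and the
    ascending chain condition, applied to proper inclusion of [L]-subgroups.
    The terms of an infinite proper chain form a non-empty set in which every
    element is properly contained in its successor, so the maximal condition
    excludes such a chain.  Conversely, in a non-empty set without maximal
    elements each element can be strictly enlarged inside the set, and dependent
    choice ([serial_sequence]) iterates this into an infinite proper chain. *)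

Local Open Scope classical_set_scope.

(** Dependent choice: the successor function is chosen on the subtype of
    elements of [S], so that its iterates never leave [S]. *)
Lemma serial_sequence (T : Type) (S : set T) (R : T -> T -> Prop) :
  S !=set0 -> (forall x, S x -> exists2 y, S y & R x y) ->
  exists u : nat -> T, forall n, S (u n) /\ R (u n) (u n.+1).
Proof.
move=> [x0 Sx0] serialR.
have /choice[next nextR] (x : {x | S x}) :
    exists y : {x | S x}, R (sval x) (sval y).
  case: x => x Sx; have [y Sy Rxy] := serialR x Sx.
  by exists (exist _ y Sy).
exists (fun n => sval (iter n next (exist _ x0 Sx0))) => n.
by split; [exact: svalP | exact: nextR].
Qed.

Lemma infinite_initial_segment (D : set nat) :
  (forall m n, m <= n -> D n -> D m) -> infinite_set D -> forall n, D n.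
Proof.
move=> downD infD n; apply: contrapT => nDn; apply: infD.
apply: (sub_finite_set _ (finite_II n)) => m Dm /=.
by rewrite ltnNge; apply/negP => le_nm; apply: nDn; apply: downD Dm.
Qed.

Theorem theorem4p2 (d : Order.disp_t) (L : latticeType d) (G : groupType)
    (mu : G -> L) :
  completely_distributive L -> Lsubgroup mu ->
  (maximal_condition mu <->
   forall (D : set nat) (eta : nat -> G -> L),
     proper_ascending_chain mu D eta -> finite_set D).
Proof.
move=> _ _; split=> [maxmu D eta [downD subeta eta_lt] | accmu S S0 Smu].
  apply: contrapT => /(infinite_initial_segment _ downD) DT.
  have range0 : range eta !=set0 by exists (eta 0); exists 0.
  have range_mu : range eta `<=` Lsubgroup_of mu.
    by move=> _ [n _ <-]; apply: subeta.
  have [_ [n _ <-] max_n] := maxmu _ range0 range_mu.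
  by apply: (max_n (eta n.+1)); [exists n.+1 | apply: eta_lt].
apply: contrapT => nomax.
have [eta Heta] : exists eta : nat -> G -> L,
    forall n, S (eta n) /\ Lproper (eta n) (eta n.+1).
  apply: serial_sequence => // x Sx; apply: contrapT => maxx.
  by apply: nomax; exists x => // y Sy ltxy; apply: maxx; exists y.
apply: infinite_nat; apply: (accmu setT eta); split=> // n _.
  by apply: Smu; case: (Heta n).
by case: (Heta n).
Qed.
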